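(* $\mathrm{ex}'(n,\{\text{taco},\text{nested},\text{david}\})\in O(n)$.
   Context: Let $P$ be a set of $n$ points in convex position in the plane (the vertices of a convex $n$-gon); a triangle on $P$ is a 3-element subset of $P$. For two distinct triangles $t_1,t_2$ on $P$, label each point of $t_1\cup t_2$ by the triangle(s) containing it and read the points in their cyclic order around the polygon. The pair forms exactly one of eight configurations. (i) If $t_1,t_2$ share two vertices $u,v$: ''taco'' if their third vertices lie on the same side of the line $uv$, ''mariposa'' if on opposite sides. (ii) If they share exactly one vertex $v$: read the remaining four vertices in cyclic order starting just after $v$; ''bat'' if the pattern is $t_1t_1t_2t_2$ or $t_2t_2t_1t_1$, ''nested'' if it is $t_1t_2t_2t_1$ or $t_2t_1t_1t_2$, ''crossing'' if it is $t_1t_2t_1t_2$ or $t_2t_1t_2t_1$. (iii) If they share no vertex, the cyclic sequence of the six labels is, up to rotation, reflection and exchanging the roles of $t_1,t_2$, one of: ''ears'' $AAABBB$, ''swords'' $AABABB$, ''david'' $ABABAB$. Top/bottom variant: partition the vertices of the convex $n$-gon by a horizontal line into a top half of $\lceil n/2\rceil$ vertices and a bottom half of $\lfloor n/2\rfloor$ vertices (each half consisting of consecutive vertices along the polygon). For a set $X$ of configurations, $\mathrm{ex}'(n,X)$ is the maximum size of a family of triangles on $P$, each having exactly two vertices in the top half and one vertex in the bottom half, in which no two triangles form a configuration belonging to $X$. *)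

(* Defs.v *)
From HB Require Import structures.
From mathcomp Require Import all_boot all_order all_algebra.
From mathcomp Require Import reals.

Set Implicit Arguments.
Unset Strict Implicit.
Unset Printing Implicit Defensive.

Import Order.TTheory GRing.Theory Num.Theory.
Local Open Scope ring_scope.

(* Twice the signed area of the triangle abc: positive iff a, b, c is a
   counterclockwise turn; for fixed a <> b, its sign tells on which side of the
   line ab the point c lies. *)
Definition orient (R : realType) (a b c : R * R) : R :=
  (b.1 - a.1) * (c.2 - a.2) - (b.2 - a.2) * (c.1 - a.1).

(* p 0, ..., p (n-1) are the vertices of a convex n-gon, listed in
   counterclockwise order.  The set P of points is thus indexed by 'I_n, whose
   order, read cyclically, is the order around the polygon. *)
Definition convex_polygon (R : realType) (n : nat) (p : 'I_n -> R * R) : Prop :=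
  forall i j k : 'I_n, (i < j)%N -> (j < k)%N -> 0 < orient (p i) (p j) (p k).

(* The horizontal line y = h cuts the polygon into a top half of uphalf n =
   ceil(n/2) vertices and a bottom half of floor(n/2) vertices.  The numbering
   of the vertices is taken to start at the first vertex of the top half. *)
Definition halving_line (R : realType) (n : nat) (p : 'I_n -> R * R) (h : R) :
    Prop :=
  forall i : 'I_n,
    if (i < uphalf n)%N then h < (p i).2 else (p i).2 < h.

Definition top_half (R : realType) (n : nat) (p : 'I_n -> R * R) (h : R) :
  {set 'I_n} := [set i | h < (p i).2].

Definition bottom_half (R : realType) (n : nat) (p : 'I_n -> R * R) (h : R) :
  {set 'I_n} := [set i | (p i).2 < h].

Inductive configuration : Type :=
  taco | mariposa | bat | nested | crossing | ears | swords | david.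

(* The labels of the points of s lying in exactly one of t1, t2, in the order
   of s: [true] stands for t1 and [false] for t2. *)
Definition labels (n : nat) (t1 t2 : {set 'I_n}) (s : seq 'I_n) : seq bool :=
  [seq i \in t1 | i <- s & (i \in t1) (+) (i \in t2)].

(* The n vertices in cyclic order, starting just after v (v comes last). *)
Definition cyclic_after (n : nat) (v : 'I_n) : seq 'I_n :=
  rot v.+1 (enum 'I_n).

(* Third vertices w1, w2 of triangles sharing exactly the vertices u, v;
   [side] compares the sides of the line uv on which they lie. *)
Definition share_two (R : realType) (n : nat) (p : 'I_n -> R * R)
    (side : R -> R -> bool) (t1 t2 : {set 'I_n}) : bool :=
  [exists u, exists v, exists w1, exists w2,
    [&& u != v, t1 :&: t2 == [set u; v],
        t1 :\: t2 == [set w1], t2 :\: t1 == [set w2]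
      & side (orient (p u) (p v) (p w1)) (orient (p u) (p v) (p w2))]].

Definition share_one (n : nat) (patterns : seq (seq bool))
    (t1 t2 : {set 'I_n}) : bool :=
  [exists v, (t1 :&: t2 == [set v])
             && (labels t1 t2 (cyclic_after v) \in patterns)].

(* The cyclic word of six labels equals w up to rotation, reflection and
   exchange of the two labels. *)
Definition share_none (n : nat) (w : seq bool) (t1 t2 : {set 'I_n}) : bool :=
  (t1 :&: t2 == set0)
  && [exists k : 'I_6, rot k (labels t1 t2 (enum 'I_n))
        \in [:: w; rev w; map negb w; map negb (rev w)]].

Definition forms (R : realType) (n : nat) (p : 'I_n -> R * R)
    (c : configuration) (t1 t2 : {set 'I_n}) : bool :=
  match c with
  | taco => share_two p (fun a b => 0 < a * b) t1 t2
  | mariposa => share_two p (fun a b => a * b < 0) t1 t2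
  | bat => share_one [:: [:: true; true; false; false];
                         [:: false; false; true; true]] t1 t2
  | nested => share_one [:: [:: true; false; false; true];
                            [:: false; true; true; false]] t1 t2
  | crossing => share_one [:: [:: true; false; true; false];
                              [:: false; true; false; true]] t1 t2
  | ears => share_none [:: true; true; true; false; false; false] t1 t2
  | swords => share_none [:: true; true; false; true; false; false] t1 t2
  | david => share_none [:: true; false; true; false; true; false] t1 t2
  end.

Definition top_triangle (R : realType) (n : nat) (p : 'I_n -> R * R) (h : R)
    (t : {set 'I_n}) : bool :=
  [&& #|t| == 3%N, #|t :&: top_half p h| == 2%N
    & #|t :&: bottom_half p h| == 1%N].

Definition avoiding_family (R : realType) (n : nat) (p : 'I_n -> R * R) (h : R)
    (X : seq configuration) (F : {set {set 'I_n}}) : bool :=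
  [forall t in F, top_triangle p h t]
  && [forall t1 in F, forall t2 in F,
        (t1 != t2) ==> ~~ has (fun c => forms p c t1 t2) X].

Definition ex' (R : realType) (n : nat) (p : 'I_n -> R * R) (h : R)
    (X : seq configuration) : nat :=
  \max_(F : {set {set 'I_n}} | avoiding_family p h X F) #|F|.

(* Main.v *)
Require Import Defs.
From mathcomp Require Import all_boot all_order all_algebra.
From mathcomp Require Import reals.
From mathcomp Require Import zify ring.

(** Number the vertices around the polygon so that a triangle of the family is
    [a < b < c] with [a], [b] on top and [c] at the bottom.  Avoiding taco, the
    pair [(a, b)] determines [c]; avoiding taco and nested, [c] increases
    strictly with [a] for fixed [b], and with [b] for fixed [a].  Hence
    triangles [(a0, b, c0)], [(a, b, c)], [(a, b1, c1)] with [a0 < a] and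
    [b < b1] would satisfy [a0 < a < b < b1 < c0 < c1], and the outer two would
    form a david.  So each triangle either has the smallest [a] for its [b] or
    the largest [b] for its [a], and there are at most [2 n] of them. *)

Set Implicit Arguments.
Unset Strict Implicit.
Unset Printing Implicit Defensive.

Import Order.TTheory GRing.Theory Num.Theory.

(** * Label words computed from explicit sorted lists of vertices *)

Section EnumOrdinal.
Variable n : nat.
Implicit Types (P : pred 'I_n) (r : seq 'I_n) (v : 'I_n).

Let ltI := [rel i j : 'I_n | i < j].

Lemma sorted_enum_ord : sorted ltI (enum 'I_n).
Proof.
have := iota_ltn_sorted 0 n; rewrite -val_enum_ord sorted_map.
by apply: sub_sorted.
Qed.

(** A strictly increasing list is determined by its members, so a label word can be computed by
    exhibiting such a list and checking membership. *)
Lemma filter_enum_ordE P r :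
  sorted ltI r -> r =i P -> filter P (enum 'I_n) = r.
Proof.
have ltI_tr : transitive ltI by move=> ? ? ? /=; apply: ltn_trans.
move=> sr rP; apply: (irr_sorted_eq ltI_tr) => //.
- by move=> i /=; rewrite ltnn.
- exact: sorted_filter ltI_tr _ _ sorted_enum_ord.
by move=> i; rewrite mem_filter mem_enum andbT rP.
Qed.

Lemma cyclic_afterE v :
  cyclic_after v =
    [seq i : 'I_n <- enum 'I_n | v < i] ++ [seq i : 'I_n <- enum 'I_n | i <= v].
Proof.
rewrite /cyclic_after /rot; congr (_ ++ _); apply: (inj_map val_inj).
- rewrite map_drop val_enum_ord drop_iota add0n.
  rewrite -(filter_map val (fun i => v < i)) val_enum_ord.
  apply: (irr_sorted_eq ltn_trans ltnn); first exact: iota_ltn_sorted.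
    by apply: sorted_filter; [apply: ltn_trans | apply: iota_ltn_sorted].
  by move=> i; rewrite mem_filter !mem_iota; have := ltn_ord v; lia.
- rewrite map_take val_enum_ord take_iota.
  rewrite -(filter_map val (fun i => i <= v)) val_enum_ord.
  apply: (irr_sorted_eq ltn_trans ltnn); first exact: iota_ltn_sorted.
    by apply: sorted_filter; [apply: ltn_trans | apply: iota_ltn_sorted].
  by move=> i; rewrite mem_filter !mem_iota; have := ltn_ord v; lia.
Qed.

Lemma labels_enum (t1 t2 : {set 'I_n}) r :
  sorted ltI r -> (forall i, (i \in r) = (i \in t1) (+) (i \in t2)) ->
  labels t1 t2 (enum 'I_n) = [seq i \in t1 | i <- r].
Proof. by move=> sr rP; rewrite /labels (filter_enum_ordE sr). Qed.

(** The reading order wraps around once, so the word splits into the vertices after [v] and those up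
    to [v], each block being increasing. *)
Lemma labels_cyclic_after (t1 t2 : {set 'I_n}) v r1 r2 :
  sorted ltI r1 -> sorted ltI r2 ->
  (forall i, (i \in r1) = ((i \in t1) (+) (i \in t2)) && (v < i)) ->
  (forall i, (i \in r2) = ((i \in t1) (+) (i \in t2)) && (i <= v)) ->
  labels t1 t2 (cyclic_after v) = [seq i \in t1 | i <- r1 ++ r2].
Proof.
move=> s1 s2 P1 P2; rewrite /labels cyclic_afterE filter_cat.
by congr (map _ (_ ++ _)); rewrite -filter_predI;
  apply: filter_enum_ordE => // i; rewrite ?P1 ?P2.
Qed.

End EnumOrdinal.

Lemma orient_rot (R : realType) (x y z : R * R) : orient y z x = orient x y z.
Proof. by rewrite /orient; ring. Qed.

Ltac ordset := rewrite ?inE -?val_eqE /=; lia.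

(** * Order constraints forced by the forbidden configurations *)

Section AvoidingFamily.
Variables (R : realType) (n : nat) (p : 'I_n -> (R * R)%type) (h : R).
Hypotheses (cvx : convex_polygon p) (hl : halving_line p h).
Variable F : {set {set 'I_n}}.
Hypothesis FP : avoiding_family p h [:: taco; nested; david] F.
Implicit Types a b c : 'I_n.

(** The halves are expressed by indices, as [halving_line] allows, so that position conditions
    become linear arithmetic. A triangle has at most one such triple. *)
Definition top_triple a b c :=
  [&& a < b, b < uphalf n, uphalf n <= c & [set a; b; c] \in F].

Lemma avoidP t1 t2 : t1 \in F -> t2 \in F -> t1 != t2 ->
  [/\ ~~ forms p taco t1 t2, ~~ forms p nested t1 t2 & ~~ forms p david t1 t2].
Proof.
move=> F1 F2 ne; case/andP: FP => _ /forall_inP/(_ _ F1)/forall_inP/(_ _ F2).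
by move/implyP/(_ ne) => /=; rewrite orbF !negb_or => /and3P[].
Qed.

(** One sign suffices: the shared edge can be oriented so that both third vertices lie to its
    left. *)
Lemma share_two_taco (t1 t2 : {set 'I_n}) u v w1 w2 :
  t1 \in F -> t2 \in F -> u != v -> w1 != w2 ->
  t1 :&: t2 = [set u; v] -> t1 :\: t2 = [set w1] -> t2 :\: t1 = [set w2] ->
  (0 < orient (p u) (p v) (p w1))%R -> (0 < orient (p u) (p v) (p w2))%R ->
  False.
Proof.
move=> F1 F2 uv w12 I D1 D2 o1 o2.
have ne : t1 != t2.
  by apply: contraTneq (set11 w1) => e; rewrite -D1 e setDv inE.
have [/negP + _ _] := avoidP F1 F2 ne; apply => /=.
apply/existsP; exists u; apply/existsP; exists v.
apply/existsP; exists w1; apply/existsP; exists w2.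
by rewrite uv I D1 D2 !eqxx mulr_gt0.
Qed.

Lemma top_triple_fun a b c c' :
  top_triple a b c -> top_triple a b c' -> c = c'.
Proof.
move=> /and4P[ab bm mc Fc] /and4P[_ _ mc' Fc'].
apply/eqP; apply/negP => /negP ne; move: (ne); rewrite -val_eqE /= => ne'.
apply: (@share_two_taco _ _ a b c c' Fc Fc') => //.
- by ordset.
- by apply/setP => i; ordset.
- by apply/setP => i; ordset.
- by apply/setP => i; ordset.
- by apply: cvx => //; lia.
- by apply: cvx => //; lia.
Qed.

Lemma top_triple_ltl a a' b c c' :
  top_triple a b c -> top_triple a' b c' -> a < a' -> c < c'.
Proof.
move=> /and4P[ab bm mc Fc] /and4P[ab' _ mc' Fc'] aa'.
case: ltngtP => // [c'c|/val_inj ecc].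
- have ne : [set a; b; c] != [set a'; b; c'].
    by apply/negP => /eqP/setP/(_ a); ordset.
  have [_ /negP + _] := avoidP Fc Fc' ne; case => /=.
  apply/existsP; exists b; apply/andP; split.
    by apply/eqP/setP => i; ordset.
  (* After [b] come [c'] and [c], then, past the wrap-around, [a] and [a']: the two labels of the
     first triangle are enclosed, which is nested. *)
  rewrite (@labels_cyclic_after _ _ _ b [:: c'; c] [:: a; a']) /=.
  + have -> : c' \in [set a; b; c] = false by ordset.
    have -> : a' \in [set a; b; c] = false by ordset.
    by rewrite !inE !eqxx !orbT.
  + by lia.
  + by lia.
  + by move=> i; ordset.
  + by move=> i; ordset.
(* With equal bottom vertices, [a] and [a'] both precede [b], hence lie on the same side of the edge
   [b c]. *)
subst c'; exfalso; apply: (@share_two_taco _ _ b c a a' Fc Fc').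
- by ordset.
- by ordset.
- by apply/setP => i; ordset.
- by apply/setP => i; ordset.
- by apply/setP => i; ordset.
- by rewrite orient_rot; apply: cvx => //; lia.
- by rewrite orient_rot; apply: cvx => //; lia.
Qed.

Lemma top_triple_ltr a b b' c c' :
  top_triple a b c -> top_triple a b' c' -> b < b' -> c < c'.
Proof.
move=> /and4P[ab bm mc Fc] /and4P[ab' bm' mc' Fc'] bb'.
case: ltngtP => // [c'c|/val_inj ecc].
- have ne : [set a; b; c] != [set a; b'; c'].
    by apply/negP => /eqP/setP/(_ b); ordset.
  have [_ /negP + _] := avoidP Fc Fc' ne; case => /=.
  apply/existsP; exists a; apply/andP; split.
    by apply/eqP/setP => i; ordset.
  (* Here all four unshared vertices follow [a], so the wrapped block is empty. *)
  rewrite (@labels_cyclic_after _ _ _ a [:: b; b'; c'; c] [::]) /=.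
  + have -> : c' \in [set a; b; c] = false by ordset.
    have -> : b' \in [set a; b; c] = false by ordset.
    by rewrite !inE !eqxx !orbT.
  + by lia.
  + by [].
  + by move=> i; ordset.
  + by move=> i; rewrite in_nil; ordset.
subst c'; exfalso; apply: (@share_two_taco _ _ c a b b' Fc Fc').
- by ordset.
- by ordset.
- by apply/setP => i; ordset.
- by apply/setP => i; ordset.
- by apply/setP => i; ordset.
- by rewrite -orient_rot; apply: cvx => //; lia.
- by rewrite -orient_rot; apply: cvx => //; lia.
Qed.

Lemma top_triple_david a a' b b' c c' :
  top_triple a b c -> top_triple a' b' c' ->
  a < a' -> a' < b -> b < b' -> c < c' -> False.
Proof.
move=> /and4P[ab bm mc Fc] /and4P[ab' bm' mc' Fc'] aa' a'b bb' cc'.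
have ne : [set a; b; c] != [set a'; b'; c'].
  by apply/negP => /eqP/setP/(_ b); ordset.
have [_ _ /negP +] := avoidP Fc Fc' ne; apply => /=.
apply/andP; split; first by apply/eqP/setP => i; ordset.
(* The least of the six vertices is [a], so the alternating word already starts with the first
   triangle's label. *)
apply/existsP; exists ord0.
rewrite rot0 (@labels_enum _ _ _ [:: a; a'; b; b'; c; c']) /=.
- have -> : a' \in [set a; b; c] = false by ordset.
  have -> : b' \in [set a; b; c] = false by ordset.
  have -> : c' \in [set a; b; c] = false by ordset.
  by rewrite !inE !eqxx !orbT.
- by lia.
- by move=> i; ordset.
Qed.

Lemma top_triple_extremal a0 a b b1 c0 c c1 :
  top_triple a0 b c0 -> top_triple a b c -> top_triple a b1 c1 ->
  a0 < a -> b < b1 -> False.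
Proof.
move=> T0 T T1 a0a bb1; apply: (top_triple_david T0 T1) => //.
  by case/andP: T.
exact: ltn_trans (top_triple_ltl T0 T a0a) (top_triple_ltr T T1 bb1).
Qed.

(** * From triangles to ordered triples, and the count *)

Lemma mem_top_triple t :
  t \in F -> exists a b c, top_triple a b c /\ t = [set a; b; c].
Proof.
move=> tF; case/andP: (FP) => /forall_inP/(_ t tF) /and3P[_ t2 t1] _.
have topE i : (i \in top_half p h) = (i < uphalf n).
  rewrite inE; have := hl i; case: ifP => // _ lt.
  by apply/negbTE; rewrite -leNgt ltW.
have botE i : (i \in bottom_half p h) = (uphalf n <= i).
  rewrite inE leqNgt; have := hl i; case: ifP => //= _ lt.
  by apply/negbTE; rewrite -leNgt ltW.
have /cards2P[x [y [xy tE]]] := t2; have /cards1P[c bE] := t1.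
wlog ltxy : x y xy tE / x < y.
  move=> W; have [|lt|/val_inj e] := ltngtP x y; first exact: W.
    by apply: (W y x); rewrite // 1?eq_sym // tE setUC.
  by rewrite e eqxx in xy.
have tdef : t = [set x; y; c].
  apply/setP => i; move/setP/(_ i): tE; move/setP/(_ i): bE.
  by rewrite !in_setI topE botE !inE; case: leqP; rewrite ?andbT ?andbF;
    case: (i \in t); case: (i == x); case: (i == y); case: (i == c).
exists x, y, c; split=> //; apply/and4P; split=> //; last by rewrite -tdef.
  by move/setP/(_ y): tE; rewrite in_setI topE !inE eqxx orbT => /andP[].
by move/setP/(_ c): bE; rewrite in_setI botE !inE eqxx => /andP[].
Qed.

Lemma card_avoiding_family : #|F| <= 2 * n.
Proof.
pose G := [set x : 'I_n * 'I_n * 'I_n | top_triple x.1.1 x.1.2 x.2].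
(* Inside [G1] the middle vertex determines the triple; outside it the first vertex does. Each part
   thus injects into ['I_n]. *)
pose G1 := [set x in G | [forall y in G, (y.1.2 == x.1.2) ==> (x.1.1 <= y.1.1)]].
have FG : #|F| <= #|G|.
  apply: leq_trans (leq_imset_card (fun x => [set x.1.1; x.1.2; x.2]) G).
  apply/subset_leq_card/subsetP => t /mem_top_triple[a [b [c [T ->]]]].
  by apply/imsetP; exists (a, b, c); rewrite // inE.
have cardI (D : {set 'I_n * 'I_n * 'I_n}) (f : _ -> 'I_n) :
    {in D &, injective f} -> #|D| <= n.
  by move=> /card_in_imset <-; rewrite -[leqRHS]card_ord max_card.
have le1 : #|G1| <= n.
  apply: (cardI _ (fun x => x.1.2)) => -[[a b] c] [[a' b'] c'].
  rewrite !inE /= => /andP[T /forall_inP m] /andP[T' /forall_inP m'] e; subst b'.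
  have /= := m (a', b, c'); rewrite inE eqxx => /(_ T') le.
  have /= := m' (a, b, c); rewrite inE eqxx => /(_ T) ge.
  have e : a = a' by apply/val_inj/anti_leq/andP.
  by subst a'; rewrite (top_triple_fun T T').
have le2 : #|G :\: G1| <= n.
  apply: (cardI _ (fun x => x.1.1)) => x x' Gx Gx' e.
  (* Failing minimality yields a triple [w] with the same middle vertex and a smaller first one;
     [top_triple_extremal] then excludes a larger middle vertex for the first vertex of [y]. *)
  have extr y z : y \in G :\: G1 -> z \in G -> y.1.1 = z.1.1 -> z.1.2 <= y.1.2.
    rewrite in_setD in_set => /andP[+ Gy] Gz eyz; rewrite Gy /= leqNgt.
    case/forall_inPn => w Gw; rewrite negb_imply -ltnNge => /andP[/eqP wb wa].
    apply/negP => lt; move: Gy Gz Gw; rewrite !inE -eyz wb => Ty Tz Tw.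
    exact: (top_triple_extremal Tw Ty Tz).
  have G_x : x \in G by case/setDP: Gx.
  have G_x' : x' \in G by case/setDP: Gx'.
  have eb : x.1.2 = x'.1.2.
    by apply/val_inj/eqP; rewrite eqn_leq (extr x' x) // (extr x x').
  move: G_x G_x' e eb {Gx Gx' extr}; case: x x' => [[a b] c] [[a' b'] c'].
  by rewrite !inE /= => T T' ea eb; subst a' b'; rewrite (top_triple_fun T T').
apply: (leq_trans FG); rewrite -(cardsID G1 G) mul2n -addnn leq_add //.
by apply: leq_trans le1; apply/subset_leq_card/subsetIr.
Qed.

End AvoidingFamily.

Theorem theorem8 (R : realType) :
  exists C N : nat, forall (n : nat) (p : 'I_n -> (R * R)%type) (h : R),
    (N <= n)%N -> convex_polygon p -> halving_line p h ->
    (ex' p h [:: taco; nested; david] <= C * n)%N.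
Proof.
exists 2, 0 => n p h _ cvx hl; apply/bigmax_leqP => F FP.
exact: (card_avoiding_family cvx hl FP).
Qed.
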